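(* Let $H$ be a Hilbert space over $\mathbf K\in\{\mathbb R,\mathbb C\}$ and let $\mathcal S$ be the normed algebra of all finite rank bounded operators on $H$. The set $B\mathscr R(\mathcal S)$ of all bounded normal cones in the category $\mathscr R(\mathcal S)$ of principal right ideals of $\mathcal S$ is a normed algebra, and this normed algebra $B\mathscr R(\mathcal S)$ is conjugate-linear isomorphic to the normed algebra $\mathcal S$.
   Context: Composition convention: operators and morphisms are composed left to right, i.e. the product is $(T_1T_2)(x)=T_2(T_1(x))$, and $fg$ means first $f$, then $g$. $\mathcal S$ carries the operator norm. For a finite-dimensional subspace $M$ of $H$, $P_M$ is the orthogonal projection of $H$ onto $M$; $Z(T)$ is the kernel of $T$. Category $\mathscr R(\mathcal S)$: objects are the principal right ideals $P\mathcal S=\{PA:A\in\mathcal S\}$ with $P\in\mathcal S$ idempotent; every object equals $P_M\mathcal S$ for a unique finite-dimensional subspace $M$ of $H$. Morphisms $P_M\mathcal S\to P_N\mathcal S$ are the maps $\lambda(P_M,T,P_N):A\mapsto TA$ for $T\in P_N\mathcal SP_M$. Inclusions are the set inclusions. For $T\in P_N\mathcal SP_M$ the norm of $\lambda(P_M,T,P_N)$ is $\|T\|$. A retraction is a morphism $q$ with $jq=1$ for some inclusion $j$. A cone $\gamma$ with vertex $d$ assigns to each object $c$ a morphism $\gamma(c):c\to d$ such that $j\gamma(c)=\gamma(c')$ for every inclusion $j:c'\to c$; its vertex is denoted $c_\gamma$. It is a normal cone if $\gamma(c)$ is an isomorphism for at least one object $c$. A normal cone $\gamma$ is bounded if there is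 $\alpha_\gamma\in\mathbb R$ with $\|\gamma(c)\|\le\alpha_\gamma$ for all objects $c$. A normal factorization of a morphism $f$ is $f=quj$ with $q$ a retraction, $u$ an isomorphism, $j$ an inclusion; $f^\circ=qu$ is the epimorphic component of $f$. Normal cones are multiplied by $(\gamma\cdot\sigma)(c)=\gamma(c)(\sigma(c_\gamma))^\circ$. For $A\in\mathcal S$ with $N=Z(A)^\perp$, $\lambda^A$ is the cone with vertex $P_N\mathcal S=A\mathcal S$ given by $\lambda^A(P_M\mathcal S)=\lambda(P_M,AP_M,P_N)$. The structure on $B\mathscr R(\mathcal S)$: multiplication is the product of normal cones, and $\lambda^{T_1}+\lambda^{T_2}=\lambda^{T_1+T_2}$, $k\lambda^{T}=\lambda^{kT}$, $\|\lambda^{T}\|=\|T\|$ for $T,T_1,T_2\in\mathcal S$, $k\in\mathbf K$. It is part of the claim that these operations are well defined on $B\mathscr R(\mathcal S)$, i.e. that every bounded normal cone is $\lambda^A$ for a unique $A\in\mathcal S$. A conjugate-linear isomorphism of normed algebras is a bijective, conjugate-linear, multiplicative, norm-preserving map. *)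

(* Defs.v *)
From HB Require Import structures.
From mathcomp Require Import all_boot all_order all_algebra.
From mathcomp Require Import complex.
From mathcomp Require Import all_classical all_reals all_analysis.

Set Implicit Arguments.
Unset Strict Implicit.
Unset Printing Implicit Defensive.

Import Order.TTheory GRing.Theory Num.Theory.
Import numFieldNormedType.Exports.

Local Open Scope classical_set_scope.
Local Open Scope ring_scope.

Inductive scalar_kind := RealScalars | ComplexScalars.

Definition scalar_field (R : realType) (k : scalar_kind) : numFieldType :=
  match k with RealScalars => R | ComplexScalars => R[i] end.

Definition sconj (R : realType) (k : scalar_kind) :
    involutive_rmorphism (scalar_field R k) :=
  match k with RealScalars => idfun | ComplexScalars => Num.conj end.

Definition sRe (R : realType) (k : scalar_kind) : scalar_field R k -> R :=
  match k return scalar_field R k -> R with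
  | RealScalars => idfun
  | ComplexScalars => @complex.Re R
  end.

(* Norms of the library take values in the scalar field itself; [snorm] and
   [hnorm] below are the same (nonnegative) numbers, seen in [R]. *)
Definition snorm (R : realType) (k : scalar_kind) (a : scalar_field R k) : R :=
  sRe `|a|.

Section ScalarFacts.
Context {R : realType} {k : scalar_kind}.
Implicit Types x y : scalar_field R k.

Lemma sReD x y : sRe (x + y) = sRe x + sRe y.
Proof. by case: (k) x y => //= -[? ?] [? ?]. Qed.

Lemma sRe_le x y : x <= y -> sRe x <= sRe y.
Proof. by case: (k) x y => //= -[? ?] [? ?]; rewrite lecE => /andP[]. Qed.

Lemma sRe0 : sRe (0 : scalar_field R k) = 0.
Proof. by case: (k). Qed.

Lemma sRe1 : sRe (1 : scalar_field R k) = 1.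
Proof. by case: (k). Qed.

Lemma sRe_eq0 x : 0 <= x -> sRe x = 0 -> x = 0.
Proof.
case: (k) x => //= -[a b]; rewrite lecE /= => /andP[/eqP b0 _] a0.
by rewrite a0 b0.
Qed.

Lemma sReM x y : 0 <= x -> 0 <= y -> sRe (x * y) = sRe x * sRe y.
Proof.
case: (k) x y => //= -[a b] [c d]; rewrite !lecE /=.
move=> /andP[/eqP b0 _] /andP[/eqP d0 _].
by rewrite b0 mul0r subr0.
Qed.

Lemma snorm_ge0 x : 0 <= snorm x.
Proof. by rewrite -sRe0; apply: sRe_le. Qed.

End ScalarFacts.

Record hilbertType (R : realType) (k : scalar_kind) := HilbertType {
  hilbert_sort :> completeNormedModType (scalar_field R k);
  hdot : {dot hilbert_sort for sconj R k};
  hdot_norm : forall x : hilbert_sort, `|x| ^+ 2 = hdot x x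
}.

Definition hnorm (R : realType) (k : scalar_kind) (H : hilbertType R k)
  (x : H) : R := sRe `|x|.

(* Not necessarily unital. *)
Record normed_algebra (R : realType) (k : scalar_kind) (T : Type) :=
  NormedAlgebra {
    na_zero : T;
    na_opp : T -> T;
    na_add : T -> T -> T;
    na_scale : scalar_field R k -> T -> T;
    na_mul : T -> T -> T;
    na_norm : T -> R;
    na_addA : associative na_add;
    na_addC : commutative na_add;
    na_add0 : left_id na_zero na_add;
    na_addN : left_inverse na_zero na_opp na_add;
    na_scaleA : forall a b x,
      na_scale a (na_scale b x) = na_scale (a * b) x;
    na_scale1 : left_id 1 na_scale;
    na_scaleDr : right_distributive na_scale na_add;
    na_scaleDl : forall x,
      {morph na_scale^~ x : a b / a + b >-> na_add a b};
    na_mulA : associative na_mul;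
    na_mulDl : left_distributive na_mul na_add;
    na_mulDr : right_distributive na_mul na_add;
    na_scaleAl : forall a x y,
      na_scale a (na_mul x y) = na_mul (na_scale a x) y;
    na_scaleAr : forall a x y,
      na_scale a (na_mul x y) = na_mul x (na_scale a y);
    na_norm_ge0 : forall x, 0 <= na_norm x;
    na_norm_eq0 : forall x, na_norm x = 0 -> x = na_zero;
    na_norm_scale : forall a x,
      na_norm (na_scale a x) = snorm a * na_norm x;
    na_norm_add : forall x y,
      na_norm (na_add x y) <= na_norm x + na_norm y;
    na_norm_mul : forall x y,
      na_norm (na_mul x y) <= na_norm x * na_norm y
  }.

Definition conj_linear_iso (R : realType) (k : scalar_kind) (T U : Type)
    (NT : normed_algebra R k T) (NU : normed_algebra R k U) (f : T -> U) :=
  [/\ bijective f,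
      forall x y, f (na_add NT x y) = na_add NU (f x) (f y),
      forall a x, f (na_scale NT a x) = na_scale NU (sconj R k a) (f x),
      forall x y, f (na_mul NT x y) = na_mul NU (f x) (f y) &
      forall x, na_norm NU (f x) = na_norm NT x].

Section Operators.
Context {R : realType} {k : scalar_kind} (H : hilbertType R k).
Local Notation K := (scalar_field R k).

Definition lspan n (v : 'I_n -> H) : set H :=
  [set x | exists a : 'I_n -> K, x = \sum_i a i *: v i].

Definition finite_dim (M : set H) := exists n (v : 'I_n -> H), M = lspan v.

Definition ortho (X : set H) : set H :=
  [set x | forall y, X y -> hdot H x y = 0].

Definition bounded_op (f : H -> H) :=
  exists r : R, forall x, hnorm (f x) <= r * hnorm x.

Definition finite_rank_op : {pred H -> H} :=
  mem [set f : H -> H | [/\ linear f, bounded_op f & finite_dim (range f)]].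

Record finop := FinOp {
  finop_fun :> H -> H;
  finopP : finop_fun \in finite_rank_op
}.

HB.instance Definition _ := [isSub for finop_fun].
HB.instance Definition _ := [Choice of finop by <:].

Lemma finop_prop (A : finop) :
  [/\ linear A, bounded_op A & finite_dim (range A)].
Proof. by have := finopP A; rewrite inE. Qed.

Lemma finop_ext (A B : finop) : A =1 B -> A = B.
Proof. by move=> AB; apply/val_inj/funext. Qed.

Lemma finop_linear (A : finop) : linear A.
Proof. by have [] := finop_prop A. Qed.

HB.instance Definition _ (A : finop) :=
  GRing.isLinear.Build K H H *:%R A (finop_linear A).

Lemma lspan_linear n (v : 'I_n -> H) a x y :
  lspan v x -> lspan v y -> lspan v (a *: x + y).
Proof.
move=> [b ->] [c ->]; exists (fun i => a * b i + c i).
rewrite scaler_sumr -big_split /=; apply: eq_bigr => i _.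
by rewrite scalerDl scalerA.
Qed.

Lemma lspan0 n (v : 'I_n -> H) : lspan v 0.
Proof.
by exists (fun=> 0); rewrite big1 // => i _; rewrite scale0r.
Qed.

Lemma lspanS n (v : 'I_n.+1 -> H) x :
  lspan v x <-> exists a y, lspan (v \o lift ord0) y /\ x = a *: v ord0 + y.
Proof.
split=> [[a ->]|[a [_ [[b ->] ->]]]].
  exists (a ord0), (\sum_(i < n) a (lift ord0 i) *: v (lift ord0 i)).
  split; first by exists (a \o lift ord0).
  by rewrite big_ord_recl.
exists (fun i => oapp b a (unlift ord0 i)).
rewrite big_ord_recl unlift_none /=; congr (_ + _).
by apply: eq_bigr => i _; rewrite liftK.
Qed.

Lemma sub_finite_dim n (v : 'I_n -> H) (M : set H) :
  M 0 -> (forall a x y, M x -> M y -> M (a *: x + y)) ->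
  M `<=` lspan v -> finite_dim M.
Proof.
elim: n v M => [|n IHn] v M M0 Mlin Mv.
  exists 0, v; apply/seteqP; split => // x [a ->].
  by rewrite big_ord0.
have [n' [v' M'E]] : finite_dim (M `&` lspan (v \o lift ord0)).
  apply: (IHn (v \o lift ord0)); [| |by move=> x []].
    by split=> //; exact: lspan0.
  move=> a x y [Mx vx] [My vy].
  by split; [exact: Mlin|exact: lspan_linear].
have [Msub|] := pselect (M `<=` lspan (v \o lift ord0)).
  by exists n', v'; rewrite -M'E; apply/seteqP; split=> [x Mx|x []//]; split => //; exact: Msub.
move=> /existsNP[m /not_implyP[Mm nm]].
have [a [w [vw mE]]] := (lspanS v m).1 (Mv _ Mm).
have a0 : a != 0.
  by apply/eqP => a0; apply: nm; rewrite mE a0 scale0r add0r.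
exists n'.+1, (fun i => oapp v' m (unlift ord0 i)).
have liftE : (fun i => oapp v' m (unlift ord0 i)) \o lift ord0 = v'.
  by apply/funext => i /=; rewrite liftK.
apply/seteqP; split=> x.
  move=> Mx; apply/lspanS; rewrite unlift_none liftE /=.
  have [b [y [vy xE]]] := (lspanS v x).1 (Mv _ Mx).
  exists (b / a), (- (b / a) *: m + x); split; last first.
    by rewrite addrA -scalerDl subrr scale0r add0r.
  rewrite -M'E; split; first exact: Mlin.
  have -> : - (b / a) *: m + x = - (b / a) *: w + y.
    rewrite mE xE scalerDr scalerA mulNr divfK // scaleNr.
    by rewrite addrACA addNr add0r.
  exact: lspan_linear.
move=> /lspanS; rewrite unlift_none liftE /= => -[b [y [vy ->]]].
by apply: Mlin => //; move: vy; rewrite -M'E => -[].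
Qed.

Lemma finite_dim_range_sub (f : H -> H) n (v : 'I_n -> H) :
  linear f -> range f `<=` lspan v -> finite_dim (range f).
Proof.
move=> lf; apply: sub_finite_dim.
  have := lf (- 1) 0 0; rewrite scaler0 addr0 scaleN1r addNr => f0.
  by exists 0.
by move=> a _ _ [x _ <-] [y _ <-]; exists (a *: x + y); rewrite ?lf.
Qed.

Lemma hnorm_ge0 (x : H) : 0 <= hnorm x.
Proof. by rewrite -(@sRe0 R k); apply: sRe_le. Qed.

Lemma hnorm0 : hnorm (0 : H) = 0.
Proof. by rewrite /hnorm normr0 sRe0. Qed.

Lemma hnorm0_eq0 (x : H) : hnorm x = 0 -> x = 0.
Proof. by move=> /sRe_eq0 x0; apply/normr0_eq0/x0. Qed.

Lemma hnormD (x y : H) : hnorm (x + y) <= hnorm x + hnorm y.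
Proof. by rewrite -sReD; apply/sRe_le/ler_normD. Qed.

Lemma hnormZ (a : K) (x : H) : hnorm (a *: x) = snorm a * hnorm x.
Proof. by rewrite /hnorm normrZ sReM. Qed.

Lemma snormM (a b : K) : snorm (a * b) = snorm a * snorm b.
Proof. by rewrite /snorm normrM sReM. Qed.

Lemma bounded_opP (f : H -> H) : bounded_op f ->
  exists2 r : R, 0 <= r & forall x, hnorm (f x) <= r * hnorm x.
Proof.
move=> [r fr]; exists `|r| => // x; apply: (le_trans (fr x)).
by rewrite ler_wpM2r ?hnorm_ge0 ?ler_norm.
Qed.

Lemma finop_submod_closed : submod_closed finite_rank_op.
Proof.
split=> [|a f g].
  rewrite inE; split.
  - by move=> a x y; rewrite scaler0 addr0.
  - by exists 0 => x; rewrite hnorm0 mul0r.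
  - exists 0, (fun=> 0); apply/seteqP; split=> x.
      by move=> [y _ <-]; exact: lspan0.
    by move=> [a ->]; rewrite big_ord0; exists 0.
rewrite !inE => -[lf /bounded_opP[r r0 fr] [n [v fv]]].
move=> [lg /bounded_opP[s s0 gs] [m [w gw]]].
have lfg : linear (a *: f + g : H -> H).
  move=> b x y; rewrite !fctE lf lg !scalerDr !scalerA [a * b]mulrC.
  by rewrite addrACA.
split => //.
- exists (snorm a * r + s) => x; rewrite mulrDl; apply: (le_trans (hnormD _ _)).
  by rewrite lerD ?gs // hnormZ -mulrA ler_wpM2l ?snorm_ge0 ?fr.
pose u i := match fintype.split i : 'I_n + 'I_m with inl i => v i | inr i => w i end.
apply: (@finite_dim_range_sub (a *: f + g) (n + m) u) => //.
move=> _ [x _ <-].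
have : range f (f x) by exists x.
have : range g (g x) by exists x.
rewrite fv gw => -[c gE] [b fE].
exists (fun i => match fintype.split i with inl i => a * b i | inr i => c i end).
rewrite big_split_ord /= !fctE fE gE scaler_sumr; congr (_ + _).
  by apply: eq_bigr => i _; rewrite /u (unsplitK (inl i)) scalerA.
by apply: eq_bigr => i _; rewrite /u (unsplitK (inr i)).
Qed.

HB.instance Definition _ :=
  GRing.isSubmodClosed.Build _ _ finite_rank_op finop_submod_closed.
HB.instance Definition _ := [SubChoice_isSubLmodule of finop by <:].

(* Operators are composed from left to right: first [A], then [B]. *)
Lemma finop_mul_subproof (A B : finop) : (B \o A) \in finite_rank_op.
Proof.
have [lA /bounded_opP[r r0 Ar] [n [v Av]]] := finop_prop A.
have [lB /bounded_opP[s s0 Bs] _] := finop_prop B.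
rewrite inE; split.
- by move=> a x y; rewrite /= lA lB.
- exists (s * r) => x; apply: (le_trans (Bs _)).
  by rewrite -mulrA ler_wpM2l.
- exists n, (B \o v); apply/seteqP; split=> x.
    move=> [y _ <-]; have : range A (A y) by exists y.
    rewrite Av => -[a /= ->]; exists a; rewrite linear_sum /=.
    by apply: eq_bigr => i _; rewrite linearZ.
  move=> [a ->].
  have : lspan v (\sum_i a i *: v i) by exists a.
  rewrite -Av => -[y _ yE]; exists y => //=.
  by rewrite yE linear_sum; apply: eq_bigr => i _; rewrite linearZ.
Qed.

Definition finop_mul (A B : finop) : finop := FinOp (finop_mul_subproof A B).

Definition finop_norm (A : finop) : R :=
  sup [set hnorm (A x) | x in [set x | hnorm x <= 1]].

Lemma finop_norm_has_sup (A : finop) :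
  has_sup [set hnorm (A x) | x in [set x | hnorm x <= 1]].
Proof.
have [_ /bounded_opP[r r0 Ar] _] := finop_prop A.
split; first by exists (hnorm (A 0)); exists 0; rewrite /= ?hnorm0.
exists r => _ [x /= x1 <-]; apply: (le_trans (Ar x)).
by rewrite -[leRHS]mulr1 ler_wpM2l.
Qed.

Lemma finop_norm_ge0 (A : finop) : 0 <= finop_norm A.
Proof.
apply: (@le_trans _ _ (hnorm (A 0))); first exact: hnorm_ge0.
apply: sup_upper_bound; first exact: finop_norm_has_sup.
by exists 0; rewrite /= ?hnorm0.
Qed.

Lemma finop_normP (A : finop) x : hnorm (A x) <= finop_norm A * hnorm x.
Proof.
have [->|x0] := eqVneq x 0; first by rewrite linear0 !hnorm0 mulr0.
have nx0 : `|x| != 0 by rewrite normr_eq0.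
have xE : x = `|x| *: (`|x|^-1 *: x) by rewrite scalerA divff ?scale1r.
have y1 : hnorm (`|x|^-1 *: x) = 1.
  by rewrite /hnorm normrZ normfV normr_id mulVf // sRe1.
rewrite {1}xE linearZ hnormZ /snorm normr_id mulrC ler_wpM2r ?hnorm_ge0 //.
apply: sup_upper_bound; first exact: finop_norm_has_sup.
by exists (`|x|^-1 *: x) => //=; rewrite y1.
Qed.

Lemma finop_norm_le (A : finop) r : 0 <= r ->
  (forall x, hnorm (A x) <= r * hnorm x) -> finop_norm A <= r.
Proof.
move=> r0 Ar; apply: ge_sup; first by have [] := finop_norm_has_sup A.
move=> _ [x /= x1 <-]; apply: (le_trans (Ar x)).
by rewrite -[leRHS]mulr1 ler_wpM2l.
Qed.

Lemma finop_norm_eq0 (A : finop) : finop_norm A = 0 -> A = 0.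
Proof.
move=> A0; apply: finop_ext => x; apply: hnorm0_eq0; apply/eqP.
by rewrite eq_le hnorm_ge0 andbT (le_trans (finop_normP A x)) // A0 mul0r.
Qed.

Lemma finop_normD (A B : finop) :
  finop_norm (A + B) <= finop_norm A + finop_norm B.
Proof.
apply: finop_norm_le => [|x]; first by rewrite addr_ge0 ?finop_norm_ge0.
rewrite mulrDl; apply: (le_trans (hnormD _ _)).
by rewrite lerD ?finop_normP.
Qed.

Lemma finop_normZ_le (a : K) (A : finop) :
  finop_norm (a *: A) <= snorm a * finop_norm A.
Proof.
apply: finop_norm_le => [|x]; first by rewrite mulr_ge0 ?finop_norm_ge0 ?snorm_ge0.
by rewrite [hnorm _]hnormZ -mulrA ler_wpM2l ?snorm_ge0 ?finop_normP.
Qed.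

Lemma finop_normZ (a : K) (A : finop) :
  finop_norm (a *: A) = snorm a * finop_norm A.
Proof.
have [->|a0] := eqVneq a 0.
  apply/eqP; rewrite eq_le finop_normZ_le /= /snorm normr0 sRe0 mul0r.
  exact: finop_norm_ge0.
apply/eqP; rewrite eq_le finop_normZ_le /=.
have := finop_normZ_le a^-1 (a *: A).
rewrite scalerA mulVf // scale1r => /(ler_wpM2l (snorm_ge0 a)).
by rewrite mulrA -snormM divff // /snorm normr1 sRe1 mul1r.
Qed.

Lemma finop_normM (A B : finop) :
  finop_norm (finop_mul A B) <= finop_norm A * finop_norm B.
Proof.
apply: finop_norm_le => [|x]; first by rewrite mulr_ge0 ?finop_norm_ge0.
apply: (le_trans (finop_normP B (A x))).
by rewrite [leRHS]mulrAC mulrC ler_wpM2r ?finop_norm_ge0 ?finop_normP.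
Qed.

Lemma finop_mulA : associative finop_mul.
Proof. by move=> A B C; exact: finop_ext. Qed.

Lemma finop_mulDl : left_distributive finop_mul +%R.
Proof.
by move=> A B C; apply: finop_ext => x; rewrite /= [LHS]linearD.
Qed.

Lemma finop_mulDr : right_distributive finop_mul +%R.
Proof. by move=> A B C; exact: finop_ext. Qed.

Lemma finop_scaleAl (a : K) (A B : finop) :
  a *: finop_mul A B = finop_mul (a *: A) B.
Proof. by apply: finop_ext => x; rewrite /= [RHS]linearZ. Qed.

Lemma finop_scaleAr (a : K) (A B : finop) :
  a *: finop_mul A B = finop_mul A (a *: B).
Proof. exact: finop_ext. Qed.

Definition finop_normed_algebra : normed_algebra R k finop :=
  NormedAlgebra (@addrA finop) (@addrC finop) (@add0r finop) (@addNr finop)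
    (@scalerA K finop) (@scale1r K finop) (@scalerDr K finop)
    (fun x a b => scalerDl x a b) finop_mulA finop_mulDl finop_mulDr
    finop_scaleAl finop_scaleAr finop_norm_ge0 finop_norm_eq0 finop_normZ
    finop_normD finop_normM.

Record fsubspace := FSubspace {
  fs_set : set H;
  fs_finite_dim : finite_dim fs_set
}.

Lemma hdotDl (x y z : H) : hdot H (x + y) z = hdot H x z + hdot H y z.
Proof. exact: linearDl. Qed.

Lemma hdotBl (x y z : H) : hdot H (x - y) z = hdot H x z - hdot H y z.
Proof. exact: linearBl. Qed.

Lemma hdotZl (a : K) (x y : H) : hdot H (a *: x) y = a * hdot H x y.
Proof. exact: linearZl_LR. Qed.

Lemma hdotDr (x y z : H) : hdot H x (y + z) = hdot H x y + hdot H x z.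
Proof. exact: linearDr. Qed.

Lemma hdotZr (a : K) (x y : H) :
  hdot H x (a *: y) = sconj R k a * hdot H x y.
Proof. exact: linearZr_LR. Qed.

Lemma hdot0r (x : H) : hdot H x 0 = 0.
Proof. exact: linear0r. Qed.

Lemma hdot0_sym (x y : H) : hdot H x y = 0 -> hdot H y x = 0.
Proof.
move=> xy.
have -> : hdot H y x = (-1) ^+ false * sconj R k (hdot H x y).
  exact: hermitian_subproof.
by rewrite xy rmorph0 mulr0.
Qed.

Lemma lspan_proj n (v : 'I_n -> H) : exists2 P : H -> H, linear P &
  forall x, lspan v (P x) /\ ortho (lspan v) (x - P x).
Proof.
elim: n v => [|n IHn] v.
  exists (fun=> 0) => [a x y|x]; first by rewrite scaler0 addr0.
  split; first exact: lspan0.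
  by move=> _ [a ->]; rewrite big_ord0 hdot0r.
have [P lP Pv] := IHn (v \o lift ord0).
have [w wE] : exists w, w = v ord0 - P (v ord0) by exists (v ord0 - P (v ord0)).
have ow y : lspan (v \o lift ord0) y -> hdot H w y = 0 by rewrite wE; apply: (Pv _).2.
have ow' y : lspan (v \o lift ord0) y -> hdot H y w = 0.
  by move=> /ow; exact: hdot0_sym.
exists (fun x => P x + (hdot H x w / hdot H w w) *: w).
  move=> a x y /=; rewrite lP linearPl /= mulrDl scalerDl scalerDr scalerA mulrA.
  by rewrite addrACA.
move=> x; split.
  apply/lspanS; set c := _ / _; exists c, (P x - c *: P (v ord0)); split.
    rewrite addrC -scaleNr; apply: lspan_linear; exact: (Pv _).1.
  by rewrite wE scalerBr [RHS]addrC -addrA [- _ + _]addrC.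
move=> y /lspanS[a [z [vz ->]]].
rewrite opprD addrA.
have dz u t : lspan (v \o lift ord0) t -> hdot H (x - P x - u *: w) t = 0.
  by move=> vt; rewrite hdotBl hdotZl ow // (Pv x).2 // mulr0 subr0.
rewrite hdotDr hdotZr (dz _ z vz) addr0.
have -> : v ord0 = w + P (v ord0) by rewrite wE subrK.
rewrite hdotDr (dz _ (P (v ord0)) (Pv _).1) addr0.
rewrite hdotBl hdotZl hdotBl (ow' (P x) (Pv _).1) subr0.
have [->|w0] := eqVneq w 0; first by rewrite !hdot0r mulr0 subrr mulr0.
by rewrite divfK ?subrr ?mulr0 // gt_eqF // neq0_dnorm_gt0.
Qed.

Lemma fsubspace_proj (M : fsubspace) :
  exists P : finop, forall x, fs_set M (P x) /\ ortho (fs_set M) (x - P x).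
Proof.
case: M => M /= [n [v ME]].
have [P lP] := lspan_proj v; rewrite -ME => PM.
have Pid x : M x -> P x = x.
  move=> Mx; have MPx : M (x - P x).
    rewrite addrC -scaleN1r; move: (PM x).1 Mx; rewrite ME; exact: lspan_linear.
  apply/esym/eqP; rewrite -subr_eq0; apply/negPn/negP => xP.
  have := neq0_dnorm_gt0 (s := hdot H) _ xP.
  by rewrite (PM x).2 ?ltxx.
have bP : bounded_op P.
  exists 1 => x; rewrite mul1r; apply: sRe_le.
  rewrite -(@ler_pXn2r _ 2) ?nnegrE // !hdot_norm.
  have o1 : hdot H (x - P x) (P x) = 0 by apply: (PM x).2; exact: (PM x).1.
  have o2 : hdot H (P x) (x - P x) = 0 by exact: hdot0_sym.
  have xE : x = P x + (x - P x) by rewrite addrC subrK.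
  rewrite [in leRHS]xE hdotDl hdotDr o2 hdotDr o1 addr0 add0r.
  by rewrite lerDl -hdot_norm exprn_ge0.
have fP : P \in finite_rank_op.
  rewrite inE; split => //; exists n, v; rewrite -ME.
  apply/seteqP; split=> x; first by move=> [y _ <-]; exact: (PM y).1.
  by move=> Mx; exists x => //; exact: Pid.
by exists (FinOp fP).
Qed.

Definition proj (M : fsubspace) : finop := projT1 (cid (fsubspace_proj M)).

Lemma projP (M : fsubspace) x :
  fs_set M (proj M x) /\ ortho (fs_set M) (x - proj M x).
Proof. exact: (projT2 (cid (fsubspace_proj M)) x). Qed.

Definition right_ideal (P : finop) : set finop :=
  [set B | exists A, B = finop_mul P A].

Record obj := Obj {
  obj_set :> set finop;
  obj_principal : exists P, finop_mul P P = P /\ obj_set = right_ideal P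
}.

(* [is_lam M T N f] says that [f] is the morphism A |-> TA from the object
   generated by [proj M] to the one generated by [proj N], where T belongs to
   (proj N) S (proj M). *)
Definition is_lam (c d : obj) (M : fsubspace) (T : finop) (N : fsubspace)
    (f : c -> d) :=
  [/\ obj_set c = right_ideal (proj M),
      obj_set d = right_ideal (proj N),
      exists A, T = finop_mul (finop_mul (proj N) A) (proj M) &
      forall A, \val (f A) = finop_mul T (\val A)].

(* Composition and identities are those of maps, so equations between
   composites are stated pointwise below, diagrams being read left to right. *)
Record hom (c d : obj) := Hom {
  hom_fun :> c -> d;
  hom_lam : exists T M N, is_lam M T N hom_fun
}.

(* The operator is determined by the morphism: T is the value at [proj M]. *)
Definition hom_op (c d : obj) (f : hom c d) : finop :=
  projT1 (cid (hom_lam f)).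

Definition hom_norm (c d : obj) (f : hom c d) : R := finop_norm (hom_op f).

Definition is_incl (c d : obj) (j : hom c d) := forall A, \val (j A) = \val A.

Definition is_iso (c d : obj) (u : hom c d) :=
  exists v : hom d c, cancel u v /\ cancel v u.

(* [cancel j q] is the equation jq = 1. *)
Definition is_retraction (c d : obj) (q : hom c d) :=
  exists j : hom d c, is_incl j /\ cancel j q.

(* f = quj is a normal factorization and p = qu; p is unique, since u and q
   are onto, so that its codomain is the range of f. *)
Definition is_epi_component (c d e : obj) (f : hom c d) (p : hom c e) :=
  exists (b : obj) (q : hom c b) (u : hom b e) (j : hom e d),
    [/\ is_retraction q, is_iso u, is_incl j,
        forall A, f A = j (u (q A)) &
        forall A, p A = u (q A)].

Record cone := Cone {
  vertex : obj;
  cone_at :> forall c : obj, hom c vertex;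
  cone_compat : forall (c' c : obj) (j : hom c' c),
    is_incl j -> forall A, cone_at c (j A) = cone_at c' A
}.

Definition is_normal (g : cone) := exists c, is_iso (g c).

Definition is_bounded (g : cone) :=
  exists alpha : R, forall c, hom_norm (g c) <= alpha.

Record bnc := Bnc {
  bnc_cone :> cone;
  bnc_normal : is_normal bnc_cone;
  bnc_bounded : is_bounded bnc_cone
}.

(* The vertex of t is the codomain of the epimorphic component p. *)
Definition is_cone_mul (g s t : cone) :=
  exists p : hom (vertex g) (vertex t),
    is_epi_component (s (vertex g)) p /\ forall c A, t c A = p (g c A).

Definition is_lambda (A : finop) (g : cone) :=
  exists N : fsubspace,
    [/\ fs_set N = ortho [set x | A x = 0],
        obj_set (vertex g) = right_ideal (proj N),
        obj_set (vertex g) = right_ideal A &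
        forall (c : obj) (M : fsubspace), obj_set c = right_ideal (proj M) ->
          is_lam M (finop_mul A (proj M)) N (g c)].

End Operators.

(* Main.v *)
(* A morphism of the category is composition with an operator, so a bounded cone
   assigns to each vector x a bounded net T_M x in M, indexed by the
   finite-dimensional M, with P_M T_L x = T_M x for M inside L. By Pythagoras the
   net is Cauchy; its limit A x defines the unique operator A with g = lambda^A,
   whose components are all X |-> AX. Hence lambda^A . lambda^B = lambda^(BA): the
   order is reversed, and it is the adjoint that turns this into a conjugate-linear
   isomorphism. *)
Require Import Defs.
From HB Require Import structures.
From mathcomp Require Import all_boot all_order all_algebra.
From mathcomp Require Import complex.
From mathcomp Require Import all_classical all_reals all_analysis.
(* The library has its own [proj] and [ortho], which would hide those of [Defs]. *)
Import Defs.

Set Implicit Arguments.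
Unset Strict Implicit.
Unset Printing Implicit Defensive.

Import Order.TTheory GRing.Theory Num.Theory.
Import numFieldNormedType.Exports.

Local Open Scope classical_set_scope.
Local Open Scope ring_scope.

(** * Inner product, norm and orthogonality *)

Section HilbertGeometry.
Context {R : realType} {k : scalar_kind} {H : hilbertType R k}.
Local Notation K := (scalar_field R k).
Implicit Types (x y z : H) (M L : fsubspace H).

Lemma sRe_lt (a b : K) : 0 <= a -> 0 <= b -> (sRe a < sRe b) = (a < b).
Proof.
case: (k) a b => //= -[a1 a2] [b1 b2].
rewrite !lecE ltcE /= => /andP[/eqP a0 _] /andP[/eqP b0 _].
by rewrite a0 b0 eqxx.
Qed.

Lemma sconjK : involutive (sconj R k).
Proof. by case: (k) => //= a; rewrite conjCK. Qed.

Lemma hdotC x y : hdot H y x = sconj R k (hdot H x y).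
Proof.
have -> : hdot H y x = (-1) ^+ false * sconj R k (hdot H x y).
  exact: hermitian_subproof.
by rewrite expr0 mul1r.
Qed.

Lemma hdotBr x y z : hdot H x (y - z) = hdot H x y - hdot H x z.
Proof. exact: linearBr. Qed.

Lemma hdot0l x : hdot H 0 x = 0.
Proof. exact/hdot0_sym/hdot0r. Qed.

Lemma hdot_eq0 x : hdot H x x = 0 -> x = 0.
Proof.
by move=> /eqP; rewrite -hdot_norm expf_eq0 /= normr_eq0 => /eqP.
Qed.

Lemma hdot_inj x y : (forall z, hdot H z x = hdot H z y) -> x = y.
Proof.
move=> xy; apply/eqP; rewrite -subr_eq0; apply/eqP/hdot_eq0.
by rewrite hdotBr xy subrr.
Qed.

Lemma hnorm_sqr x : hnorm x ^+ 2 = sRe (hdot H x x).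
Proof. by rewrite -hdot_norm !expr2 sReM. Qed.

Lemma hnormN x : hnorm (- x) = hnorm x.
Proof. by rewrite /hnorm normrN. Qed.

Lemma pythagoras x y :
  hdot H x y = 0 -> hnorm (x + y) ^+ 2 = hnorm x ^+ 2 + hnorm y ^+ 2.
Proof.
move=> xy; have yx := hdot0_sym xy.
by rewrite !hnorm_sqr hdotDl !hdotDr xy yx addr0 add0r sReD.
Qed.

Lemma hnorm_le_ortho x y : hdot H x y = 0 -> hnorm x <= hnorm (x + y).
Proof.
move=> /pythagoras xy.
by rewrite -(@ler_pXn2r _ 2) ?nnegrE ?hnorm_ge0 // xy lerDl exprn_ge0 ?hnorm_ge0.
Qed.

(** The component [p] of [x] along [y] has norm at most [hnorm x] by Pythagoras; multiplying this
    inequality by [hnorm y] gives the claim. *)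
Lemma cauchy_schwarz x y : snorm (hdot H x y) <= hnorm x * hnorm y.
Proof.
have [->|y0] := eqVneq y 0.
  by rewrite hdot0r hnorm0 mulr0 /snorm normr0 sRe0.
have yy0 : hdot H y y != 0 by apply/eqP => /hdot_eq0/eqP; apply/negP.
set p := (hdot H x y / hdot H y y) *: y.
have op : hdot H p (x - p) = 0.
  by apply: hdot0_sym; rewrite hdotBl /p hdotZr hdotZr hdotZl divfK ?subrr.
have xE : x = p + (x - p) by rewrite addrC subrK.
have := hnorm_le_ortho op; rewrite -xE /p hnormZ => /(ler_wpM2r (hnorm_ge0 y)).
rewrite -mulrA -expr2 hnorm_sqr.
have -> : sRe (hdot H y y) = snorm (hdot H y y).
  by rewrite /snorm -hdot_norm normrX normr_id.
by rewrite -snormM divfK.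
Qed.

(** Serves to bound representing vectors and adjoints, whose squared norm is a value of the
    functional at the vector itself. *)
Lemma hnorm_le_sqr x (r : R) : 0 <= r ->
  hnorm x ^+ 2 <= r * hnorm x -> hnorm x <= r.
Proof.
move=> r0; have [->|x0] := eqVneq (hnorm x) 0; first by [].
by rewrite expr2 ler_pM2r // lt_def x0 hnorm_ge0.
Qed.

Lemma finopB (A : finop H) x y : A (x - y) = A x - A y.
Proof. exact: linearB. Qed.

Lemma finopD (A : finop H) x y : A (x + y) = A x + A y.
Proof. exact: linearD. Qed.

Lemma finopZ (A : finop H) a x : A (a *: x) = a *: A x.
Proof. exact: linearZ. Qed.

(** * Finite-dimensional subspaces, their projections, and limits of coherent families *)

Lemma fs_linear M a x y : fs_set M x -> fs_set M y -> fs_set M (a *: x + y).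
Proof. by case: M => _ /= [n [v ->]]; exact: lspan_linear. Qed.

Lemma fs0 M : fs_set M 0.
Proof. by case: M => _ /= [n [v ->]]; exact: lspan0. Qed.

Lemma fsB M x y : fs_set M x -> fs_set M y -> fs_set M (x - y).
Proof. by move=> Mx My; rewrite addrC -scaleN1r; exact: fs_linear. Qed.

Lemma fsZ M a x : fs_set M x -> fs_set M (a *: x).
Proof. by move=> Mx; rewrite -[_ *: _]addr0; apply: fs_linear => //; exact: fs0. Qed.

Lemma proj_in M x : fs_set M (proj M x).
Proof. exact: (projP M x).1. Qed.

Lemma proj_ortho M x y : fs_set M y -> hdot H (x - proj M x) y = 0.
Proof. exact: (projP M x).2. Qed.

(** Two candidates for the projection differ by a vector of [M] that is orthogonal to [M]. *)
Lemma projE M x y : fs_set M y -> ortho (fs_set M) (x - y) -> proj M x = y.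
Proof.
move=> My oxy; apply/eqP; rewrite -subr_eq0; apply/eqP/hdot_eq0.
have Mz : fs_set M (proj M x - y) by apply: fsB => //; exact: proj_in.
have {1}-> : proj M x - y = (x - y) - (x - proj M x).
  by rewrite opprB [RHS]addrC addrA subrK.
by rewrite hdotBl proj_ortho // oxy // subrr.
Qed.

Lemma proj_id M x : fs_set M x -> proj M x = x.
Proof. by move=> Mx; apply: projE => // y _; rewrite subrr hdot0l. Qed.

Lemma proj_eq0 M x : ortho (fs_set M) x -> proj M x = 0.
Proof. by move=> ox; apply: projE; [exact: fs0|rewrite subr0]. Qed.

Lemma projK M x : proj M (proj M x) = proj M x.
Proof. exact/proj_id/proj_in. Qed.

Lemma proj_sub M L x : fs_set M `<=` fs_set L ->
  proj M (proj L x) = proj M x.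
Proof.
move=> ML; apply/esym/projE => [|y My]; first exact: proj_in.
have -> : x - proj M (proj L x)
    = (x - proj L x) + (proj L x - proj M (proj L x)) by rewrite addrA subrK.
by rewrite hdotDl !proj_ortho ?addr0 //; exact: ML.
Qed.

Lemma hdot_projr M x y : fs_set M x -> hdot H x (proj M y) = hdot H x y.
Proof.
move=> Mx; apply/esym/eqP; rewrite -subr_eq0 -hdotBr; apply/eqP/hdot0_sym.
exact: proj_ortho.
Qed.

Lemma hnorm_proj M x : hnorm (proj M x) <= hnorm x.
Proof.
have -> : hnorm x = hnorm (proj M x + (x - proj M x)) by rewrite addrC subrK.
by apply/hnorm_le_ortho/hdot0_sym/proj_ortho/proj_in.
Qed.

Lemma lspan_gen n (v : 'I_n -> H) i : lspan v (v i).
Proof.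
exists (fun j => (j == i)%:R); rewrite (bigD1 i) //= eqxx scale1r big1 ?addr0 //.
by move=> j /negPf ->; rewrite scale0r.
Qed.

Definition fs_span n (v : 'I_n -> H) : fsubspace H :=
  FSubspace (ex_intro _ n (ex_intro _ v erefl)).

Definition fs_line x : fsubspace H := fs_span (fun _ : 'I_1 => x).

Lemma fs_line_in x : fs_set (fs_line x) x.
Proof. exact: (lspan_gen (fun _ : 'I_1 => x) ord0). Qed.

Definition fs_range (A : finop H) : fsubspace H :=
  FSubspace (let: And3 _ _ h := finop_prop A in h).

Lemma fs_range_in (A : finop H) x : fs_set (fs_range A) (A x).
Proof. by exists x. Qed.

Lemma fs_join M L :
  exists N : fsubspace H, fs_set M `<=` fs_set N /\ fs_set L `<=` fs_set N.
Proof.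
have [[n [v ->]] [m [w ->]]] := (fs_finite_dim M, fs_finite_dim L).
exists (fs_span (fun i : 'I_(n + m) =>
  match fintype.split i with inl i => v i | inr i => w i end)) => /=.
split=> _ [a ->].
  exists (fun i => match fintype.split i with inl i => a i | inr i => 0 end).
  rewrite big_split_ord /= [X in _ + X]big1.
    by rewrite addr0; apply: eq_bigr => i _; rewrite (unsplitK (inl i)).
  by move=> i _; rewrite (unsplitK (inr i)) scale0r.
exists (fun i => match fintype.split i with inl i => 0 | inr i => a i end).
rewrite big_split_ord /= [X in _ = X + _]big1.
  by rewrite add0r; apply: eq_bigr => i _; rewrite (unsplitK (inr i)).
by move=> i _; rewrite (unsplitK (inl i)) scale0r.
Qed.

(** The projection onto the line spanned by [x - y] already separates [x] from [y]. *)
Lemma proj_inj x y : (forall M, proj M x = proj M y) -> x = y.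
Proof.
move=> xy; apply/eqP; rewrite -subr_eq0.
have := xy (fs_line (x - y)) => /eqP; rewrite -subr_eq0 -finopB.
by rewrite proj_id //; exact: fs_line_in.
Qed.

(* The norms of the [z M] increase with [M], so that by Pythagoras the net [z]
   is Cauchy; [x] is its limit. *)
Lemma coherent_family (z : fsubspace H -> H) (r : R) :
  (forall M, fs_set M (z M)) ->
  (forall M L, fs_set M `<=` fs_set L -> proj M (z L) = z M) ->
  (forall M, hnorm (z M) <= r) ->
  exists x, forall M, proj M x = z M.
Proof.
move=> zM zP zr.
pose up M : set H := [set z L | L in [set L | fs_set M `<=` fs_set L]].
(* The filter generated by the tails of the net; [fs_join] makes the index set directed. *)
pose F : set_system H := filter_from setT up.
have upF M : F (up M) by exists M.
have FF : ProperFilter F.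
  apply: filter_from_proper.
    apply: filter_from_filter; first by exists (fs_line 0).
    move=> M L _ _; have [N [MN LN]] := fs_join M L.
    exists N => // _ [N' NN' <-]; split; exists N' => //=.
      exact: subset_trans MN NN'.
    exact: subset_trans LN NN'.
  by move=> M _; exists (z M), M.
pose E := [set hnorm (z M) ^+ 2 | M in setT].
have E_sup : has_sup E.
  split; first by exists (hnorm (z (fs_line 0)) ^+ 2), (fs_line 0).
  exists (r ^+ 2) => _ [M _ <-]; rewrite ler_pXn2r ?nnegrE ?hnorm_ge0 //.
  exact: le_trans (hnorm_ge0 _) (zr M).
have cF : cauchy F.
  apply: cauchy_exP => e e0.
  have e0' : 0 < sRe e by rewrite -(@sRe0 R k) sRe_lt // ltW.
  (* Choose [M] with squared norm within [sRe e ^+ 2] of the supremum: for [L] above [M], the square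
     of [hnorm (z L - z M)] is the increase of the squared norms, hence smaller than that. *)
  have [_ [M _ <-] ME] := sup_adherent (exprn_gt0 2 e0') E_sup.
  exists (z M), M => // _ [L ML <-].
  rewrite -ball_normE /= -sRe_lt ?(ltW e0) // -/(hnorm _).
  rewrite -(@ltr_pXn2r _ 2) ?nnegrE ?hnorm_ge0 ?(ltW e0') //.
  have zL : z L = z M + (z L - z M) by rewrite addrC subrK.
  have o : hdot H (z M) (z L - z M) = 0.
    by apply: hdot0_sym; rewrite -(zP M L ML) proj_ortho // zP.
  have := pythagoras o; rewrite -zL -[in X in _ + X]hnormN opprB => LE.
  have : hnorm (z L) ^+ 2 <= sup E by apply: sup_upper_bound => //; exists L.
  rewrite LE => h; rewrite -(ltrD2l (hnorm (z M) ^+ 2)).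
  by apply: le_lt_trans h _; rewrite -ltrBlDr.
have /fcvg_ballP Fx := @cauchy_cvg H F FF cF.
exists (lim F) => M; apply/eqP; rewrite -subr_eq0 -normr_eq0.
(* Were the distance from [proj M (lim F)] to [z M] positive, some [z N] with [N] above [M] would be
   closer than this to the limit; but [proj M] is a contraction and sends [z N] to [z M]. *)
apply/negPn/negP => d0.
have [] := Fx `|proj M (lim F) - z M|; first by rewrite lt_def d0 normr_ge0.
move=> L _ zL; have [N [MN LN]] := fs_join M L.
have /zL : up L (z N) by exists N.
rewrite -ball_normE /= -sRe_lt // -(zP M N MN) -finopB ltNge.
by rewrite -!/(hnorm _) hnorm_proj.
Qed.

End HilbertGeometry.

(** * Riesz representation, adjoints and pseudo-inverses *)

Section FiniteRankOperators.
Context {R : realType} {k : scalar_kind} {H : hilbertType R k}.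
Local Notation K := (scalar_field R k).
Implicit Types (x y z : H) (M L : fsubspace H) (A B : finop H).

Lemma hnorm_sqr_snorm x : hnorm x ^+ 2 = snorm (hdot H x x).
Proof. by rewrite hnorm_sqr /snorm -hdot_norm normrX normr_id. Qed.

Lemma sconj_div (a b : K) :
  sconj R k (sconj R k a / b) = a / sconj R k b.
Proof. by rewrite rmorphM fmorphV; congr (_ / _); exact: sconjK. Qed.

(** The classical argument inside [M]: if [phi] is nonzero on [M], a vector [w] of [M] outside the
    kernel [N] and orthogonal to it represents [phi] after rescaling. *)
Lemma riesz_fs M (phi : H -> K) :
  (forall a x y, phi (a *: x + y) = a * phi x + phi y) ->
  exists z, fs_set M z /\ forall x, fs_set M x -> phi x = hdot H x z.
Proof.
move=> lphi.
have phi0 : phi 0 = 0.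
  by have := lphi (-1) 0 0; rewrite scaler0 addr0 mulN1r addNr.
have [[m [Mm m0]]|h] := pselect (exists m, fs_set M m /\ phi m != 0); last first.
  exists 0; split=> [|x Mx]; first exact: fs0.
  by rewrite hdot0r; apply/eqP/negPn/negP => x0; apply: h; exists x.
have fN : finite_dim (fs_set M `&` [set x | phi x = 0]).
  have [n [v Mv]] := fs_finite_dim M.
  apply: (@sub_finite_dim _ _ _ n v); last by rewrite Mv => x [].
    by split => //; exact: fs0.
  move=> a x y [Mx x0] [My y0]; split; first exact: fs_linear.
  by rewrite /= lphi x0 y0 mulr0 addr0.
pose N := FSubspace fN.
pose w := m - proj N m.
have [MPm Pm0] : fs_set M (proj N m) /\ phi (proj N m) = 0 := proj_in N m.
have Mw : fs_set M w by exact: fsB.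
have wm : phi w = phi m.
  by rewrite /w addrC -scaleN1r lphi Pm0 mulr0 add0r.
have w0 : phi w != 0 by rewrite wm.
have ww0 : hdot H w w != 0.
  by apply: contraNneq w0 => /hdot_eq0 ->; rewrite phi0.
exists ((sconj R k (phi w) / hdot H w w) *: w); split; first exact: fsZ.
move=> x Mx; rewrite hdotZr sconj_div -hdotC.
(* The second vector lies in the kernel [N], to which [w] is orthogonal. *)
have : hdot H w (x - (phi x / phi w) *: w) = 0.
  apply: proj_ortho; split.
    by apply: fsB => //; exact: fsZ.
  by rewrite /= addrC -scaleNr lphi mulNr divfK // addNr.
move=> /hdot0_sym; rewrite hdotBl hdotZl => /eqP; rewrite subr_eq0 => /eqP ->.
by rewrite [phi x / phi w * _]mulrC mulrA divfK // mulrC divfK.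
Qed.

(** The vectors representing [phi] on the finite-dimensional subspaces form a coherent family
    bounded by [r]; its limit represents [phi], as one sees at [y] on the line spanned by [y]. *)
Lemma riesz (phi : H -> K) (r : R) : 0 <= r ->
  (forall a x y, phi (a *: x + y) = a * phi x + phi y) ->
  (forall x, snorm (phi x) <= r * hnorm x) ->
  exists z, forall x, phi x = hdot H x z.
Proof.
move=> r0 lphi bphi.
have [z zP] := choice (fun M => riesz_fs M lphi).
have [||M|x xP] := @coherent_family _ _ _ z r.
- by move=> M; exact: (zP M).1.
- move=> M L ML; apply: projE => [|y My]; first exact: (zP M).1.
  apply: hdot0_sym; rewrite hdotBr -(zP M).2 // -(zP L).2 ?subrr //.
  exact: ML.
- apply: hnorm_le_sqr => //.
  by rewrite hnorm_sqr_snorm -(zP M).2 //; exact: (zP M).1.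
exists x => y; rewrite (zP (fs_line y)).2 -?xP ?hdot_projr //; exact: fs_line_in.
Qed.

(** Induction on the spanning vectors: [w] is the part of the first one orthogonal to the others, so
    in [x = a *: w + z] both summands have norm at most [hnorm x]. *)
Lemma linear_bounded_fs M (f : H -> H) : linear f ->
  exists2 r : R, 0 <= r & forall x, fs_set M x -> hnorm (f x) <= r * hnorm x.
Proof.
move=> lf; case: M => _ /= [n [v ->]].
have f0 : f 0 = 0.
  by have := lf (- 1) 0 0; rewrite scaler0 addr0 scaleN1r addNr.
elim: n v => [|n IHn] v.
  by exists 0 => // _ [a ->]; rewrite big_ord0 f0 hnorm0 mulr0.
have [r r0 rv] := IHn (v \o lift ord0).
pose N := fs_span (v \o lift ord0).
pose w := v ord0 - proj N (v ord0).
(* If [w = 0], the quotient is 0 by the convention for division by zero, and [f w = 0] as well. *)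
exists (hnorm (f w) / hnorm w + r).
  by rewrite addr_ge0 ?divr_ge0 ?hnorm_ge0.
move=> x /lspanS[a [y [vy xE]]].
pose z := a *: proj N (v ord0) + y.
have Nz : fs_set N z by apply: fs_linear => //; exact: proj_in.
have -> : x = a *: w + z.
  by rewrite /z addrA -scalerDr subrK.
have o : hdot H (a *: w) z = 0 by rewrite hdotZl proj_ortho ?mulr0.
have wx := hnorm_le_ortho o.
have zx := hnorm_le_ortho (hdot0_sym o); rewrite [z + _]addrC in zx.
rewrite lf mulrDl; apply: le_trans (hnormD _ _) _; apply: lerD; last first.
  by apply: le_trans (rv _ Nz) _; rewrite ler_wpM2l.
have [->|w0] := eqVneq w 0.
  by rewrite f0 scaler0 hnorm0 mul0r mul0r.
have nw0 : 0 < hnorm w.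
  by rewrite lt_def hnorm_ge0 andbT; apply: contraNneq w0 => /hnorm0_eq0 ->.
rewrite hnormZ mulrC -mulrA ler_wpM2l ?hnorm_ge0 //.
by rewrite mulrC ler_pdivlMr // -hnormZ.
Qed.

(** Since [f] factors through [proj M], its range is spanned by the images of vectors spanning
    [M]. *)
Lemma finop_of_fun M (f : H -> H) : linear f -> bounded_op f ->
  (forall x, f (proj M x) = f x) -> exists A, A =1 f.
Proof.
move=> lf bf fM.
suff fF : f \in @finite_rank_op R k H by exists (FinOp fF).
rewrite inE; split => //.
have [n [v Mv]] := fs_finite_dim M.
apply: (@finite_dim_range_sub _ _ _ f n (f \o v)) => // _ [x _ <-].
have := proj_in M x; rewrite Mv -fM => -[a ->]; exists a.
pose g : {linear H -> H} := HB.pack f (GRing.isLinear.Build K H H *:%R f lf).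
rewrite -[f]/(g : H -> H) linear_sum.
by apply: eq_bigr => i _; rewrite linearZ.
Qed.

Lemma finop_of_linear M (f : H -> H) : linear f ->
  (forall x, f (proj M x) = f x) -> exists A, A =1 f.
Proof.
move=> lf fM; apply: (finop_of_fun lf) => //.
have [r r0 rf] := linear_bounded_fs M lf.
exists r => x; rewrite -fM; apply: le_trans (rf _ (proj_in M x)) _.
by rewrite ler_wpM2l // hnorm_proj.
Qed.

(** Riesz gives the value at each [y]. The adjoint has finite rank because it factors through the
    projection onto the range of [A]; Cauchy-Schwarz bounds it. *)
Lemma adj_exists A : exists B, forall x y, hdot H (A x) y = hdot H x (B y).
Proof.
have /choice[f fP] y : exists z, forall x, hdot H (A x) y = hdot H x z.
  apply: (@riesz (fun x => hdot H (A x) y) (finop_norm A * hnorm y)).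
  - by rewrite mulr_ge0 ?finop_norm_ge0 ?hnorm_ge0.
  - by move=> a u v; rewrite finopD finopZ hdotDl hdotZl.
  - move=> x; apply: le_trans (cauchy_schwarz _ _) _.
    by rewrite mulrAC ler_wpM2r ?hnorm_ge0 ?finop_normP.
suff [B BP] : exists B, B =1 f by exists B => x y; rewrite BP.
apply: (@finop_of_fun (fs_range A)).
- move=> a x y; apply: hdot_inj => z.
  by rewrite -fP hdotDr hdotZr !fP hdotDr hdotZr.
- exists (finop_norm A) => y; apply: hnorm_le_sqr.
    by rewrite mulr_ge0 ?finop_norm_ge0 ?hnorm_ge0.
  rewrite hnorm_sqr_snorm -fP; apply: le_trans (cauchy_schwarz _ _) _.
  by rewrite mulrAC ler_wpM2r ?hnorm_ge0 ?finop_normP.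
- move=> y; apply: hdot_inj => z.
  by rewrite -!fP hdot_projr //; exact: fs_range_in.
Qed.

Definition adj A : finop H := projT1 (cid (adj_exists A)).

Lemma adjP A x y : hdot H (A x) y = hdot H x (adj A y).
Proof. exact: (projT2 (cid (adj_exists A)) x y). Qed.

Lemma adjK : involutive adj.
Proof.
move=> A; apply: finop_ext => x; apply: hdot_inj => z.
by rewrite -adjP hdotC -adjP -hdotC.
Qed.

Lemma adjD A B : adj (A + B) = adj A + adj B.
Proof.
apply: finop_ext => x; apply: hdot_inj => z.
by rewrite -adjP [RHS]hdotDr -!adjP -hdotDl.
Qed.

Lemma adjZ a A : adj (a *: A) = sconj R k a *: adj A.
Proof.
apply: finop_ext => x; apply: hdot_inj => z.
by rewrite -adjP [RHS]hdotZr sconjK -!adjP -hdotZl.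
Qed.

Lemma adjM A B : adj (finop_mul A B) = finop_mul (adj B) (adj A).
Proof.
by apply: finop_ext => x; apply: hdot_inj => z; rewrite -adjP /= !adjP.
Qed.

Lemma adj_norm_le A : finop_norm (adj A) <= finop_norm A.
Proof.
apply: finop_norm_le => [|y]; first exact: finop_norm_ge0.
apply: hnorm_le_sqr; first by rewrite mulr_ge0 ?finop_norm_ge0 ?hnorm_ge0.
rewrite hnorm_sqr_snorm -adjP; apply: le_trans (cauchy_schwarz _ _) _.
by rewrite mulrAC ler_wpM2r ?hnorm_ge0 ?finop_normP.
Qed.

Lemma adj_norm A : finop_norm (adj A) = finop_norm A.
Proof.
by apply/eqP; rewrite eq_le adj_norm_le -{1}[A]adjK adj_norm_le.
Qed.

(** The orthogonal complement of the kernel of [A], see [fs_suppE]; as the range of the adjoint it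
    is finite-dimensional by construction. *)
Definition fs_supp A := fs_range (adj A).

Lemma proj_supp_eq0 A x : A x = 0 -> proj (fs_supp A) x = 0.
Proof.
by move=> Ax0; apply: proj_eq0 => _ [y _ <-]; rewrite -adjP Ax0 hdot0l.
Qed.

(** The vector [x - proj (fs_supp A) x] is orthogonal to the range of the adjoint, hence killed by
    [A]. *)
Lemma proj_supp A x : A (proj (fs_supp A) x) = A x.
Proof.
apply/esym/eqP; rewrite -subr_eq0 -finopB; apply/eqP/hdot_eq0.
by rewrite adjP proj_ortho //; exact: fs_range_in.
Qed.

Lemma fs_suppE A : fs_set (fs_supp A) = ortho [set x | A x = 0].
Proof.
apply/seteqP; split=> [_ [y _ <-] x /= Ax0|x xA].
  by apply: hdot0_sym; rewrite -adjP Ax0 hdot0l.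
suff -> : x = proj (fs_supp A) x by exact: proj_in.
apply/eqP; rewrite -subr_eq0; apply/eqP/hdot_eq0.
(* The difference of [x] and its projection lies in the kernel of [A], so it is orthogonal to [x],
   and it is orthogonal to the projection too. *)
rewrite hdotBl xA; last by rewrite /= finopB proj_supp subrr.
by rewrite (hdot0_sym (proj_ortho _ (proj_in _ _))) subrr.
Qed.

(** The Moore-Penrose inverse: project [y] to the range, take any preimage under [A], project it to
    [fs_supp A]. Two preimages differ by a kernel vector, which the last projection kills, so the
    result is independent of the choice and linear. *)
Lemma pinv_exists A : exists B,
  [/\ forall x, B (A x) = proj (fs_supp A) x,
      forall y, A (B y) = proj (fs_range A) y,
      forall y, B (proj (fs_range A) y) = B y &
      forall y, proj (fs_supp A) (B y) = B y].
Proof.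
have /choice[s sP] y : exists x, A x = proj (fs_range A) y.
  by have [x _ xE] := proj_in (fs_range A) y; exists x.
pose f y := proj (fs_supp A) (s y).
have fA x y : A x = proj (fs_range A) y -> f y = proj (fs_supp A) x.
  move=> xy; apply/eqP; rewrite -subr_eq0 -finopB; apply/eqP.
  by apply: proj_supp_eq0; rewrite finopB sP xy subrr.
have [|y|B BP] := @finop_of_linear (fs_range A) f.
- move=> a x y.
  by rewrite (fA (a *: s x + s y)) !finopD !finopZ ?sP //= finopD finopZ.
- by apply: fA; rewrite projK sP.
exists B; split=> [x|y|y|y]; rewrite !BP.
- by apply: fA; rewrite proj_id //; exact: fs_range_in.
- by rewrite proj_supp sP.
- by apply: fA; rewrite projK sP.
- exact: projK.
Qed.

End FiniteRankOperators.

(** * The category of principal right ideals *)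

Section Cones.
Context {R : realType} {k : scalar_kind} {H : hilbertType R k}.
Implicit Types (M N : fsubspace H) (A B T : finop H) (c d e : obj H).
Local Notation "A ** B" := (finop_mul A B) (at level 40, left associativity).

Lemma obj_ext c d : obj_set c = obj_set d -> c = d.
Proof.
case: c d => [c hc] [d hd] /= cd; case: _ / cd in hd *.
by congr Obj; exact: Prop_irrelevance.
Qed.

Lemma hom_ext c d (f g : hom c d) : (forall X, \val (f X) = \val (g X)) -> f = g.
Proof.
case: f g => [f hf] [g hg] /= fg.
have E : f = g by apply/funext => X; exact/val_inj/fg.
by case: _ / E in hg *; congr Hom; exact: Prop_irrelevance.
Qed.

Lemma cone_ext (g h : cone H) : obj_set (vertex g) = obj_set (vertex h) ->
  (forall c (X : c), \val (g c X) = \val (h c X)) -> g = h.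
Proof.
case: g h => [v g gj] [w h hj] /= /obj_ext vw.
(* The types of the components depend on the vertex, so the vertices are identified first. *)
case: _ / vw in h hj * => gh.
have E : g = h by apply: functional_extensionality_dep => c; exact/hom_ext/gh.
by case: _ / E in hj *; congr Cone; exact: Prop_irrelevance.
Qed.

Lemma bnc_inj : injective (@bnc_cone R k H).
Proof.
move=> [g gn gb] [h hn hb] /= E; case: _ / E in hn hb *.
by congr Bnc; exact: Prop_irrelevance.
Qed.

Lemma obj_mem c (X : c) : obj_set c (\val X).
Proof. by have := valP X; rewrite inE. Qed.

Lemma obj_elt c X : obj_set c X -> exists Y : c, \val Y = X.
Proof. by move=> cX; exists (SigSub (mem_set cX)). Qed.

(** Products being read left to right, the ideal of [proj M] consists of the operators that vanish
    on the orthogonal complement of [M]. *)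
Lemma right_ideal_proj M X : right_ideal (proj M) X <-> proj M ** X = X.
Proof.
split=> [[Y ->]|<-]; last by exists X.
by apply: finop_ext => x /=; rewrite projK.
Qed.

(** The algebra need not have a unit; the projection onto the range of [A] is a right unit for
    [A]. *)
Lemma right_ideal_self A : right_ideal A A.
Proof.
exists (proj (fs_range A)); apply: finop_ext => x /=.
by rewrite proj_id //; exact: fs_range_in.
Qed.

(** One inclusion is [proj_supp]; for the other, [A] times its pseudo-inverse is the projection onto
    [fs_supp A]. *)
Lemma right_ideal_supp A : right_ideal A = right_ideal (proj (fs_supp A)).
Proof.
have [B [BA _ _ _]] := pinv_exists A.
apply/seteqP; split=> _ [X ->].
  by apply/right_ideal_proj/finop_ext => x /=; rewrite proj_supp.
by exists (B ** X); apply: finop_ext => x /=; rewrite BA.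
Qed.

Lemma right_idealM B A C :
  right_ideal A = right_ideal C -> right_ideal (B ** A) = right_ideal (B ** C).
Proof.
move=> AC; apply/seteqP; split=> _ [X ->].
  have [Y YE] : right_ideal C A by rewrite -AC; exact: right_ideal_self.
  by exists (Y ** X); rewrite YE !finop_mulA.
have [Y YE] : right_ideal A C by rewrite AC; exact: right_ideal_self.
by exists (Y ** X); rewrite YE !finop_mulA.
Qed.

Lemma proj_idem M : proj M ** proj M = proj M.
Proof. by apply: finop_ext => x /=; rewrite projK. Qed.

Definition obj_of_fs M : obj H :=
  Obj (ex_intro _ (proj M) (conj (proj_idem M) erefl)).

Lemma obj_fs c : exists M, obj_set c = right_ideal (proj M).
Proof.
by have [P [_ ->]] := obj_principal c; exists (fs_supp P); exact: right_ideal_supp.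
Qed.

Lemma hom_exists c d M N T : obj_set c = right_ideal (proj M) ->
  obj_set d = right_ideal (proj N) -> proj N ** T = T -> T ** proj M = T ->
  exists f : hom c d, is_lam M T N f.
Proof.
move=> cM dN NT TM.
have dT (X : c) : (T ** \val X) \in obj_set d.
  by rewrite inE dN; apply/right_ideal_proj; rewrite finop_mulA NT.
have fl : is_lam M T N (fun X : c => SigSub (dT X)).
  by split=> //; exists T; rewrite NT TM.
by exists (Hom (ex_intro _ T (ex_intro _ M (ex_intro _ N fl)))).
Qed.

(** Each projection lies in the ideal of the other, so both kill [proj M x - proj N x]; moving them
    across the inner product shows that this vector is orthogonal to itself. *)
Lemma right_ideal_proj_inj M N :
  right_ideal (proj M) = right_ideal (proj N) -> proj M = proj N.
Proof.
move=> MN.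
have MNx x : proj M (proj N x) = proj M x.
  have : right_ideal (proj N) (proj M) by rewrite -MN; exact: right_ideal_self.
  by move=> /right_ideal_proj/(congr1 (fun A : finop H => A x)).
have NMx x : proj N (proj M x) = proj N x.
  have : right_ideal (proj M) (proj N) by rewrite MN; exact: right_ideal_self.
  by move=> /right_ideal_proj/(congr1 (fun A : finop H => A x)).
apply: finop_ext => x; apply/eqP; rewrite -subr_eq0; apply/eqP/hdot_eq0.
have zN : proj N (proj M x - proj N x) = 0 by rewrite finopB NMx projK subrr.
have zM : proj M (proj M x - proj N x) = 0 by rewrite finopB MNx projK subrr.
rewrite [X in hdot H X _]/= hdotBl.
rewrite -(hdot_projr _ (proj_in M x)) -(hdot_projr _ (proj_in N x)) zM zN.
by rewrite !hdot0r subrr.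
Qed.

(** Makes the witness chosen by [hom_op] irrelevant: both operators absorb the projection on the
    right, so both equal the value of [f] at [proj M]. *)
Lemma is_lam_op c d (f : hom c d) M N T : is_lam M T N f -> hom_op f = T.
Proof.
rewrite /hom_op; case: cid => T' /= [M' [N' [cM' _ [A' T'E] fT']]].
move=> [cM _ [A TE] fT].
have [X XE] : exists X : c, \val X = proj M.
  by apply: obj_elt; rewrite cM; exact: right_ideal_self.
have MM' : proj M' = proj M by apply: right_ideal_proj_inj; rewrite -cM' cM.
have := fT X; rewrite fT' XE.
rewrite -{1}MM' TE T'E -!finop_mulA !proj_idem.
by rewrite !finop_mulA.
Qed.

Lemma hom_op_lam c d (f : hom c d) M N : obj_set c = right_ideal (proj M) ->
  obj_set d = right_ideal (proj N) -> is_lam M (hom_op f) N f.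
Proof.
move=> cM dN; have [T [M' [N' fT]]] := hom_lam f.
rewrite (is_lam_op fT); case: fT => cM' dN' [A TE] fT.
split=> //; exists A.
have -> : proj M = proj M' by apply: right_ideal_proj_inj; rewrite -cM.
by have -> : proj N = proj N' by apply: right_ideal_proj_inj; rewrite -dN.
Qed.

(** The inclusion is left multiplication by the projection generating [c], which fixes every element
    of [c]. *)
Lemma incl_exists c d : obj_set c `<=` obj_set d ->
  exists j : hom c d, is_incl j.
Proof.
move=> cd; have [M cM] := obj_fs c; have [N dN] := obj_fs d.
have /right_ideal_proj NM : right_ideal (proj N) (proj M).
  by rewrite -dN; apply: cd; rewrite cM; exact: right_ideal_self.
have [j [_ _ _ jP]] := hom_exists cM dN NM (proj_idem M).
exists j => X; rewrite jP; apply/right_ideal_proj.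
by rewrite -cM; exact: obj_mem.
Qed.

(** The inverse is left multiplication by the pseudo-inverse of [T]. *)
Lemma iso_of_op c d (f : hom c d) T :
  obj_set c = right_ideal (proj (fs_range T)) -> obj_set d = right_ideal T ->
  (forall X, \val (f X) = T ** \val X) -> is_iso f.
Proof.
move=> cT; rewrite right_ideal_supp => dT fT.
have [B [BT TB Br Bs]] := pinv_exists T.
have [||v [_ _ _ vB]] := hom_exists dT cT (T := B).
- by apply: finop_ext => x /=; rewrite Br.
- by apply: finop_ext => x /=; rewrite Bs.
exists v; split=> X; apply: val_inj; rewrite !(vB, fT) finop_mulA.
  have -> : B ** T = proj (fs_range T) by apply: finop_ext => x; exact: TB.
  by apply/right_ideal_proj; rewrite -cT; exact: obj_mem.
have -> : T ** B = proj (fs_supp T) by apply: finop_ext => x; exact: BT.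
by apply/right_ideal_proj; rewrite -dT; exact: obj_mem.
Qed.

(** * The cones given by operators, and their products *)

Lemma is_lambdaP A (g : cone H) : is_lambda A g <->
  obj_set (vertex g) = right_ideal A /\
  forall c (X : c), \val (g c X) = A ** \val X.
Proof.
split=> [[N [_ _ gA gc]]|[gA gc]].
  split=> // c X; have [M cM] := obj_fs c; have [_ _ _ ->] := gc c M cM.
  (* Elements of the object absorb [proj M], so every component is left multiplication by [A]
     itself. *)
  rewrite -finop_mulA; congr (_ ** _); apply/right_ideal_proj.
  by rewrite -cM; exact: obj_mem.
exists (fs_supp A); split=> //.
- exact: fs_suppE.
- by rewrite gA right_ideal_supp.
move=> c M cM; split=> //.
- by rewrite gA right_ideal_supp.
- exists A; congr (_ ** _).
  by apply: finop_ext => x /=; rewrite proj_supp.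
move=> X; rewrite gc -finop_mulA; congr (_ ** _); apply/esym/right_ideal_proj.
by rewrite -cM; exact: obj_mem.
Qed.

Lemma is_lambda_uniq A (g h : cone H) : is_lambda A g -> is_lambda A h -> g = h.
Proof.
move=> /is_lambdaP[gA gc] /is_lambdaP[hA hc].
by apply: cone_ext => [|c X]; rewrite ?gA ?gc.
Qed.

(** The component at [M], evaluated at [proj M], recovers [proj M (A x)], and these projections
    determine [A x]. *)
Lemma is_lambda_inj A B (g : cone H) : is_lambda A g -> is_lambda B g -> A = B.
Proof.
move=> /is_lambdaP[_ gA] /is_lambdaP[_ gB].
apply: finop_ext => x; apply: proj_inj => M.
have [X XM] : exists X : obj_of_fs M, \val X = proj M.
  by apply: obj_elt; exact: right_ideal_self.
by have := gA _ X; rewrite gB XM => /(congr1 (fun A : finop H => A x)).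
Qed.

(** The component at the range of [A] is an isomorphism by [iso_of_op], and [finop_norm A] bounds
    all components because projections are contractions. *)
Lemma lambda_exists A : exists g : bnc H, is_lambda A g.
Proof.
pose v := obj_of_fs (fs_supp A).
have gex c : exists f : hom c v, forall X, \val (f X) = A ** \val X.
  have [M cM] := obj_fs c.
  have [||f [_ _ _ fA]] := @hom_exists c v M (fs_supp A) (A ** proj M) cM erefl.
  - by apply: finop_ext => x /=; rewrite proj_supp.
  - by rewrite -finop_mulA proj_idem.
  exists f => X; rewrite fA -finop_mulA; congr (_ ** _); apply/right_ideal_proj.
  by rewrite -cM; exact: obj_mem.
pose g c := projT1 (cid (gex c)).
have gP c X : \val (g c X) = A ** \val X by exact: (projT2 (cid (gex c)) X).
have gj c' c (j : hom c' c) : is_incl j -> forall X, g c (j X) = g c' X.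
  by move=> ji X; apply: val_inj; rewrite !gP ji.
have vA : obj_set v = right_ideal A by rewrite right_ideal_supp.
have gA : is_lambda A (Cone gj) by apply/is_lambdaP.
have gn : is_normal (Cone gj).
  by exists (obj_of_fs (fs_range A)); apply: (iso_of_op _ vA) => //; exact: gP.
have gb : is_bounded (Cone gj).
  exists (finop_norm A) => c; have [M cM] := obj_fs c.
  have [N [_ _ _ /(_ c M cM) gc]] := gA.
  rewrite /hom_norm (is_lam_op gc); apply: finop_norm_le => [|x].
    exact: finop_norm_ge0.
  exact: le_trans (hnorm_proj _ _) (finop_normP _ _).
by exists (Bnc gn gb).
Qed.

Lemma bnc_lambda (g : bnc H) : exists A, is_lambda A g.
Proof.
have [r gr] := bnc_bounded g; have [c0 [v0 [_ v0K]]] := bnc_normal g.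
have [N gN] := obj_fs (vertex g).
pose T M := hom_op (g (obj_of_fs M)).
have gT M : is_lam M (T M) N (g (obj_of_fs M)) by exact: hom_op_lam.
have TM M x : fs_set M (T M x).
  by have [_ _ [A ->] _] := gT M; exact: proj_in.
have TN M x : T M (proj N x) = T M x.
  by have [_ _ [A ->] _] := gT M; rewrite /= projK.
have Tj M L : fs_set M `<=` fs_set L -> forall x, proj M (T L x) = T M x.
  move=> ML x.
  have [j ji] : exists j : hom (obj_of_fs M) (obj_of_fs L), is_incl j.
    apply: incl_exists => X /right_ideal_proj <-; exists (proj M ** X).
    by apply: finop_ext => y /=; rewrite proj_sub.
  have [X XM] : exists X : obj_of_fs M, \val X = proj M.
    by apply: obj_elt; exact: right_ideal_self.
  (* Compatibility with the inclusion, evaluated at the generator, reads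
     [T L ** proj M = T M ** proj M]. *)
  have := congr1 \val (cone_compat g ji X).
  have [_ _ _ ->] := gT M; have [_ _ _ ->] := gT L.
  rewrite ji XM => /(congr1 (fun A : finop H => A x)) /= ->.
  exact: proj_id.
have r0 : 0 <= r by apply: le_trans (gr c0); exact: finop_norm_ge0.
have Tr M x : hnorm (T M x) <= r * hnorm x.
  by apply: le_trans (finop_normP _ _) _; rewrite ler_wpM2r ?hnorm_ge0 ?gr.
have /choice[a aP] x : exists z, forall M, proj M z = T M x.
  apply: (@coherent_family _ _ _ (T^~ x) (r * hnorm x)) => // M L ML.
  exact: Tj.
have [A aA] : exists A, A =1 a.
  (* Finite rank comes from the vertex: every [T M], hence the limit [a], factors through
     [proj N]. *)
  apply: (@finop_of_fun _ _ _ N).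
  - move=> b x y; apply: proj_inj => M.
    by rewrite aP !finopD !finopZ !aP.
  - exists r => x.
    by rewrite -(proj_id (fs_line_in (a x))) aP.
  - by move=> x; apply: proj_inj => M; rewrite !aP TN.
have gA c (X : c) : \val (g c X) = A ** \val X.
  have [M cM] := obj_fs c.
  have {}cM : c = obj_of_fs M by exact: obj_ext.
  rewrite cM in X *; have [_ _ _ ->] := gT M.
  have <- : proj M ** \val X = \val X.
    by apply/right_ideal_proj; exact: (obj_mem X).
  apply: finop_ext => x /=; rewrite aA aP proj_id //; exact: TM.
exists A; apply/is_lambdaP; split=> //.
apply/seteqP; split=> X.
  (* Normality enters here: the component at [c0] is onto, so every element of the vertex is a
     multiple of [A]. *)
  by move=> /obj_elt[Y <-]; rewrite -(v0K Y) gA; exists (\val (v0 Y)).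
move=> [Y ->]; rewrite gN; apply/right_ideal_proj; rewrite finop_mulA.
congr (_ ** _); apply: finop_ext => x /=.
by rewrite !aA; apply: proj_inj => M; rewrite !aP TN.
Qed.

(** The epimorphic component of left multiplication by [B] on the ideal of [A] is the same map with
    codomain cut down to the ideal of [B ** A]. *)
Lemma cone_mulP A B (g s t : cone H) : is_lambda A g -> is_lambda B s ->
  is_cone_mul g s t <-> is_lambda (B ** A) t.
Proof.
move=> /is_lambdaP[vg gA] /is_lambdaP[vs sB]; split.
  move=> [p [[b [q [u [j [[i [_ iq]] [v [_ vu]] ji sE pE]]]]] tE]].
  have pB Y : \val (p Y) = B ** \val Y by rewrite -sB sE ji pE.
  apply/is_lambdaP; split=> [|c X]; last by rewrite tE pB gA finop_mulA.
  apply/seteqP; split=> X.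
    move=> /obj_elt[Y <-].
    (* The map [p] is onto: [i] is a section of [q] and [v] an inverse of [u]. *)
    have -> : Y = p (i (v Y)) by rewrite pE iq vu.
    have [Z ZE] : right_ideal A (\val (i (v Y))) by rewrite -vg; exact: obj_mem.
    by exists Z; rewrite pB ZE finop_mulA.
  move=> [Y ->].
  have [Z ZE] : exists Z : vertex g, \val Z = A ** Y.
    by apply: obj_elt; rewrite vg; exists Y.
  by rewrite -finop_mulA -ZE -pB; exact: obj_mem.
move=> /is_lambdaP[vt tBA].
(* The normal factorization: [T] is [B] restricted to the ideal of [A]. As [L] lies in [M], left
   multiplication by [proj L] is a retraction [q]; then [T] acts as an isomorphism [u] from the
   ideal of [proj L] onto that of [T], which is included in the ideal of [B]. *)
pose M := fs_supp A; pose T := B ** proj M; pose L := fs_range T.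
have vgM : obj_set (vertex g) = right_ideal (proj M).
  by rewrite vg right_ideal_supp.
have vtT : obj_set (vertex t) = right_ideal T.
  by rewrite vt; apply: right_idealM; exact: right_ideal_supp.
have vtS : obj_set (vertex t) = right_ideal (proj (fs_supp T)).
  by rewrite vtT right_ideal_supp.
have ML x : proj M (proj L x) = proj L x.
  have [y _ <-] := proj_in L x.
  by rewrite /T /= projK.
have LM x : proj L (proj M x) = proj L x.
  by apply: proj_sub => _ [y _ <-]; exact: proj_in.
have TL : T ** proj L = T.
  by apply: finop_ext => x /=; rewrite proj_id //; exact: (fs_range_in T).
have ST : proj (fs_supp T) ** T = T.
  by apply: finop_ext => x; exact: proj_supp.
have TY (Y : vertex g) : T ** \val Y = B ** \val Y.
  rewrite -finop_mulA; congr (_ ** _); apply/right_ideal_proj.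
  by rewrite -vgM; exact: obj_mem.
have LX (X : obj_of_fs L) : proj L ** \val X = \val X.
  by apply/right_ideal_proj; exact: (obj_mem X).
have [||q [_ _ _ qP]] := @hom_exists (vertex g) (obj_of_fs L) M L (proj L) vgM erefl.
- exact: proj_idem.
- exact: finop_ext.
have [i iP] : exists i : hom (obj_of_fs L) (vertex g), is_incl i.
  apply: incl_exists => X /right_ideal_proj <-; rewrite vgM; exists (proj L ** X).
  by apply: finop_ext => x /=; rewrite LM.
have [u [_ _ _ uP]] := @hom_exists (obj_of_fs L) _ L _ T erefl vtS ST TL.
have [j jP] : exists j : hom (vertex t) (vertex s), is_incl j.
  apply: incl_exists; rewrite vt vs => _ [Y ->].
  by exists (A ** Y); rewrite finop_mulA.
have [|p [_ _ _ pP]] := @hom_exists _ _ _ _ T vgM vtS ST.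
  by rewrite -finop_mulA proj_idem.
exists p; split; last first.
  by move=> c X; apply: val_inj; rewrite tBA pP TY gA finop_mulA.
exists (obj_of_fs L), q, u, j; split => //.
- by exists i; split=> // X; apply: val_inj; rewrite qP iP LX.
- exact: (iso_of_op _ vtT).
- by move=> Y; apply: val_inj; rewrite jP uP qP finop_mulA TL TY sB.
- by move=> Y; apply: val_inj; rewrite pP uP qP finop_mulA TL.
Qed.

End Cones.

(** * The normed algebra of bounded normal cones *)

Lemma transport_opposite_algebra (R : realType) (k : scalar_kind) (T U : Type)
    (N : normed_algebra R k U) (f : T -> U) (g : U -> T) :
  cancel f g -> cancel g f ->
  exists N' : normed_algebra R k T,
    [/\ forall x y, f (na_add N' x y) = na_add N (f x) (f y),
        forall a x, f (na_scale N' a x) = na_scale N a (f x),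
        forall x y, f (na_mul N' x y) = na_mul N (f y) (f x) &
        forall x, na_norm N' x = na_norm N (f x)].
Proof.
move=> fK gK.
unshelve eexists (@NormedAlgebra R k T (g (na_zero N))
  (fun x => g (na_opp N (f x))) (fun x y => g (na_add N (f x) (f y)))
  (fun a x => g (na_scale N a (f x))) (fun x y => g (na_mul N (f y) (f x)))
  (fun x => na_norm N (f x)) _ _ _ _ _ _ _ _ _ _ _ _ _ _ _ _ _ _);
  last by split=> *; rewrite /= ?gK.
- by move=> x y z; rewrite /= !gK na_addA.
- by move=> x y; rewrite /= na_addC.
- by move=> x; rewrite /= gK na_add0 fK.
- by move=> x; rewrite /= gK na_addN.
- by move=> a b x; rewrite /= gK na_scaleA.
- by move=> x; rewrite /= na_scale1 fK.
- by move=> a x y; rewrite /= !gK na_scaleDr.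
- by move=> x a b; rewrite /= !gK na_scaleDl.
- by move=> x y z; rewrite /= !gK na_mulA.
(* In the opposite algebra left and right laws trade places. *)
- by move=> x y z; rewrite /= !gK na_mulDr.
- by move=> x y z; rewrite /= !gK na_mulDl.
- by move=> a x y; rewrite /= !gK na_scaleAr.
- by move=> a x y; rewrite /= !gK na_scaleAl.
- by move=> x; exact: na_norm_ge0.
- by move=> x x0; rewrite -(na_norm_eq0 x0) fK.
- by move=> a x; rewrite /= gK na_norm_scale.
- by move=> x y; rewrite /= gK na_norm_add.
- by move=> x y; rewrite /= gK mulrC na_norm_mul.
Qed.

Theorem theorem5p3 (R : realType) (k : scalar_kind) (H : hilbertType R k) :
  exists (lam : finop H -> bnc H) (N : normed_algebra R k (bnc H)),
    [/\ (forall (A : finop H) (g : cone H),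
           is_lambda A g <-> g = bnc_cone (lam A)) /\
        bijective lam,
        forall (g s : bnc H) (t : cone H),
          is_cone_mul g s t <-> t = bnc_cone (na_mul N g s),
        forall A B : finop H, na_add N (lam A) (lam B) = lam (A + B),
        (forall (a : scalar_field R k) (A : finop H),
           na_scale N a (lam A) = lam (a *: A)) /\
        (forall A : finop H, na_norm N (lam A) = finop_norm A) &
        exists f : bnc H -> finop H,
          conj_linear_iso N (finop_normed_algebra H) f].
Proof.
have [lam lamP] := choice (@lambda_exists R k H).
have [op opP] := choice (@bnc_lambda R k H).
have lamE A (g : cone H) : is_lambda A g <-> g = lam A.
  by split=> [/is_lambda_uniq|->//]; apply.
have opK : cancel op lam by move=> g; apply: bnc_inj; exact/esym/lamE/opP.
have lamK : cancel lam op by move=> A; exact: is_lambda_inj (opP _) (lamP A).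
have [N [ND NZ NM Nn]] :=
  transport_opposite_algebra (finop_normed_algebra H) opK lamK.
exists lam, N; split.
- by split=> //; exists op.
- move=> g s t; rewrite (cone_mulP t (opP g) (opP s)) lamE.
  have -> : finop_mul (op s) (op g) = op (na_mul N g s) by rewrite NM.
  by rewrite opK.
- by move=> A B; rewrite -[LHS]opK ND !lamK.
- split=> [a A|A]; first by rewrite -[LHS]opK NZ lamK.
  by rewrite Nn lamK.
(* The map [op] is linear and reverses products; the adjoint reverses them back, conjugates scalars
   and preserves the norm. *)
exists (fun g => adj (op g)); split.
- exists (fun A => lam (adj A)) => x; first by rewrite adjK opK.
  by rewrite lamK adjK.
- by move=> g s; rewrite ND; exact: adjD.
- by move=> a g; rewrite NZ; exact: adjZ.
- by move=> g s; rewrite NM; exact: adjM.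
- by move=> g; rewrite Nn; exact: adj_norm.
Qed.
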